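(* Let $R$ be an artinian noncommutative ring. Then the following statements are equivalent. (1) $\overrightarrow{\Gamma}_{E}(R)$ is connected. (2) $\overrightarrow{\Gamma}(R)$ is connected. (3) Every one-sided identity element of $R$ is a two-sided identity of $R$.
   Context: Rings are associative, and here are not assumed to have an identity element. ''Artinian'' is understood in the usual unqualified sense, i.e. both left and right artinian (descending chain condition on left ideals and on right ideals). An element $e\in R$ is a left (resp. right) identity if $er=r$ (resp. $re=r$) for all $r\in R$; a one-sided identity is an element that is a left identity or a right identity. For $A\subseteq R$, $A^{*}=A\setminus\{0\}$. An element $x\in R$ is a left (resp. right) zero divisor if $xy=0$ (resp. $yx=0$) for some $y\in R^{*}$; $Z(R)$ is the set of all elements that are left or right zero divisors. All digraphs are simple (no loops, no multiple arcs). The zero-divisor digraph $\overrightarrow{\Gamma}(R)$ has vertex set $Z(R)^{*}$, and for distinct $x,y\in Z(R)^{*}$, $x\to y$ is an arc iff $xy=0$. The extended zero-divisor digraph $\overrightarrow{\Gamma}_{E}(R)$ has the same vertex set, and for distinct $x,y\in Z(R)^{*}$, $x\to y$ is an arc iff $x^{n}y^{m}=0$ for some positive integers $n,m$ with $x^{n}\neq 0$ and $y^{m}\neq 0$. A digraph is connected if for every two distinct vertices $x,y$ there is a directed path from $x$ to $y$. *)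

(* Defs.v *)
From HB Require Import structures.
From mathcomp Require Import all_boot all_algebra.
From mathcomp Require Import boolp classical_sets.

Set Implicit Arguments.
Unset Strict Implicit.
Unset Printing Implicit Defensive.

Import GRing.Theory.
Local Open Scope classical_set_scope.
Local Open Scope ring_scope.

(* Associative rings that need not have an identity element: MathComp's
   semiring and ring structures all carry a 1.  The product is the
   semigroup product of [monoid.v], written [(x * y)%g]. *)
HB.mixin Record Zmodule_Semigroup_isRng R of GRing.Zmodule R & Semigroup R := {
  rng_mulDl : left_distributive (fun x y : R => (x * y)%g) +%R;
  rng_mulDr : right_distributive (fun x y : R => (x * y)%g) +%R
}.

#[short(type="rngType")]
HB.structure Definition Rng :=
  { R of GRing.Zmodule R & Semigroup R & Zmodule_Semigroup_isRng R }.

Section RngTheory.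
Variable R : rngType.
Implicit Types (x y e : R) (I : set R).

(* Meaningful for [0 < n] only: without an identity there is no [x ^ 0], and
   the value at [n = 0] is the dummy 0. *)
Definition rng_exp x (n : nat) : R := iterop n (fun a b : R => (a * b)%g) x 0.

Definition noncommutative_rng := ~ commutative (fun x y : R => (x * y)%g).

Definition is_additive_subgroup I :=
  [/\ I 0, (forall x y, I x -> I y -> I (x + y)) & (forall x, I x -> I (- x))].

Definition is_left_ideal I :=
  is_additive_subgroup I /\ (forall r x, I x -> I (r * x)%g).

Definition is_right_ideal I :=
  is_additive_subgroup I /\ (forall x r, I x -> I (x * r)%g).

Definition descending_chain_condition (P : set R -> Prop) :=
  forall I : nat -> set R,
    (forall n, P (I n)) -> (forall n, I n.+1 `<=` I n) ->
    exists N, forall n, (N <= n)%N -> I n = I N.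

Definition left_artinian := descending_chain_condition is_left_ideal.
Definition right_artinian := descending_chain_condition is_right_ideal.
Definition artinian := left_artinian /\ right_artinian.

Definition is_left_identity e := forall r : R, (e * r)%g = r.
Definition is_right_identity e := forall r : R, (r * e)%g = r.
Definition is_one_sided_identity e := is_left_identity e \/ is_right_identity e.
Definition is_two_sided_identity e := is_left_identity e /\ is_right_identity e.

Definition is_left_zero_divisor x := exists y, y <> 0 /\ (x * y)%g = 0.
Definition is_right_zero_divisor x := exists y, y <> 0 /\ (y * x)%g = 0.

Definition zero_divisors : set R :=
  [set x | is_left_zero_divisor x \/ is_right_zero_divisor x].

End RngTheory.

Arguments noncommutative_rng R : clear implicits.
Arguments left_artinian R : clear implicits.
Arguments right_artinian R : clear implicits.
Arguments artinian R : clear implicits.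
Arguments zero_divisors R : clear implicits.

Record digraph (T : Type) := Digraph {
  is_vertex : set T;
  is_arc : T -> T -> Prop;
  is_arc_vertex : forall x y, is_arc x y -> is_vertex x /\ is_vertex y;
  is_arc_loopless : forall x, ~ is_arc x x
}.

(* The vertices of the directed path are those of [x :: p]. *)
Definition is_dipath (T : eqType) (G : digraph T) (x y : T) (p : seq T) :=
  [/\ path (fun u v => `[< is_arc G u v >]) x p, last x p = y & uniq (x :: p)].

Definition digraph_connected (T : eqType) (G : digraph T) :=
  forall x y, is_vertex G x -> is_vertex G y -> x <> y ->
    exists p, is_dipath G x y p.

Section DigraphOn.
Variables (T : Type) (V : set T) (e : T -> T -> Prop).

Definition arc_on x y := [/\ V x, V y, x <> y & e x y].

Lemma arc_on_vertex x y : arc_on x y -> V x /\ V y.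
Proof. by case. Qed.

Lemma arc_on_loopless x : ~ arc_on x x.
Proof. by case. Qed.

Definition digraph_on : digraph T := Digraph arc_on_vertex arc_on_loopless.

End DigraphOn.

Definition zero_divisor_digraph (R : rngType) : digraph R :=
  digraph_on (zero_divisors R `\ 0) (fun x y => (x * y)%g = 0).

Definition extended_zero_divisor_digraph (R : rngType) : digraph R :=
  digraph_on (zero_divisors R `\ 0)
    (fun x y => exists n m : nat,
       [/\ (0 < n)%N, (0 < m)%N, (rng_exp x n * rng_exp y m)%g = 0,
           rng_exp x n <> 0 & rng_exp y m <> 0]).

(* Main.v *)
Require Import Defs.
From mathcomp Require Import all_boot all_algebra.
From HB Require Import structures.
From mathcomp Require Import boolp classical_sets.

(** By a criterion of Redmond, the zero-divisor digraph is connected as soon as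
    left and right zero divisors coincide: any two vertices x, y are then
    joined by a walk of length at most 3.  Indeed one may pick nonzero a, b
    with x a = 0 and b y = 0; then x, a, b, y is a walk if a b = 0, and
    x, a b, y is one otherwise ([connected_of_same_zero_divisors]).

    The link with identities comes from the descending chain condition.  If x
    is not a left zero divisor, left multiplication by x is an injective
    endomorphism of the right module R, hence onto by Fitting's argument
    ([mul_surjective]).  Solving x e = x yields a left identity e, because
    x (e r) = x r can be cancelled.  If e is two-sided, then solving x s = e
    makes x right invertible, so x is not a right zero divisor either.  The
    opposite ring gives the symmetric implication.

    Conversely, a left identity e that is not a right identity is a
    sink of the extended digraph: its powers are all e, and e kills nothing.
    But it is not alone: y = r e - r is nonzero for some r and satisfies
    y e = 0, so both e and y are vertices and no path leads from e to y.
    A right identity that is not a left identity is a source in the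
    same way.  As the extended digraph contains the ordinary one, its
    connectedness lies between the other two conditions. *)

Set Implicit Arguments.
Unset Strict Implicit.
Unset Printing Implicit Defensive.

Import GRing.Theory.
Local Open Scope classical_set_scope.
Local Open Scope ring_scope.

(** * Rings without identity *)

Section RngArithmetic.
Variable R : rngType.
Implicit Types x y e r s : R.

Lemma rng_mulr0 x : (x * 0)%g = 0 :> R.
Proof. by apply: (addrI (x * 0)%g); rewrite -rng_mulDr !addr0. Qed.

Lemma rng_mul0r x : (0 * x)%g = 0 :> R.
Proof. by apply: (addrI (0 * x)%g); rewrite -rng_mulDl !addr0. Qed.

Lemma rng_mulrN x y : (x * - y)%g = - (x * y)%g.
Proof. by apply: (addrI (x * y)%g); rewrite -rng_mulDr !subrr rng_mulr0. Qed.

Lemma rng_mulNr x y : (- x * y)%g = - (x * y)%g.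
Proof. by apply: (addrI (x * y)%g); rewrite -rng_mulDl !subrr rng_mul0r. Qed.

Lemma rng_mulrBr x y z : (x * (y - z))%g = (x * y)%g - (x * z)%g.
Proof. by rewrite rng_mulDr rng_mulrN. Qed.

Lemma rng_mulrBl x y z : ((y - z) * x)%g = (y * x)%g - (z * x)%g.
Proof. by rewrite rng_mulDl rng_mulNr. Qed.

Lemma rng_exp_idem e n : (e * e)%g = e -> (0 < n)%N -> rng_exp e n = e.
Proof.
move=> ee; case: n => // n _; elim: n => // n IHn.
by rewrite -[RHS]ee -[X in _ = (_ * X)%g]IHn.
Qed.

End RngArithmetic.

(** The left-handed notions of the opposite ring are the right-handed ones of
    R, mostly by conversion; it serves to prove one side of each statement on
    zero divisors only. *)
Definition opposite_rng (R : rngType) : Type := R.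

Section OppositeRng.
Variable R : rngType.

Let opp_mul (x y : opposite_rng R) : opposite_rng R := (y * x : R)%g.

Let opp_mulA : associative opp_mul.
Proof. by move=> x y z; rewrite /opp_mul mulgA. Qed.

HB.instance Definition _ := GRing.Zmodule.on (opposite_rng R).
HB.instance Definition _ := hasMul.Build (opposite_rng R) opp_mul.
HB.instance Definition _ := Magma_isSemigroup.Build (opposite_rng R) opp_mulA.

Let opp_mulDl :
  left_distributive (fun x y : opposite_rng R => (x * y)%g) +%R.
Proof. by move=> x y z; apply: (@rng_mulDr R). Qed.

Let opp_mulDr :
  right_distributive (fun x y : opposite_rng R => (x * y)%g) +%R.
Proof. by move=> x y z; apply: (@rng_mulDl R). Qed.

HB.instance Definition _ :=
  Zmodule_Semigroup_isRng.Build (opposite_rng R) opp_mulDl opp_mulDr.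

Lemma right_artinian_opposite :
  left_artinian R -> right_artinian (opposite_rng R).
Proof.
move=> art I idealI; apply: art => n; have [addI mulI] := idealI n.
by split=> [|r x /mulI]; [exact: addI | exact].
Qed.

End OppositeRng.

(** * Zero divisors in artinian rings *)

Section ZeroDivisors.
Variable R : rngType.
Implicit Types x y e r s : R.

Lemma mul_injective x :
  ~ is_left_zero_divisor x -> injective (fun r => x * r)%g.
Proof.
move=> nzd r s /= xrs; apply: subr0_eq; apply: contrapT => rs0.
by apply: nzd; exists (r - s); rewrite rng_mulrBr xrs subrr.
Qed.

Lemma right_ideal_iter_mul x n :
  is_right_ideal (range (iter n (fun r : R => x * r)%g)).
Proof.
split; last first.
  move=> _ s [r _ <-]; exists (r * s)%g => //.
  by elim: n => //= n ->; rewrite mulgA.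
split.
- by exists 0 => //; elim: n => //= n ->; rewrite rng_mulr0.
- move=> _ _ [r _ <-] [s _ <-]; exists (r + s) => //.
  by elim: n => //= n ->; rewrite rng_mulDr.
- move=> _ [r _ <-]; exists (- r) => //.
  by elim: n => //= n ->; rewrite rng_mulrN.
Qed.

(** The images x^n R decrease, so x^N R = x^(N+1) R for some N, and x^N can be
    cancelled from x^N r = x^N (x s). *)
Lemma mul_surjective x : right_artinian R -> ~ is_left_zero_divisor x ->
  forall r, exists s, (x * s)%g = r.
Proof.
move=> art nzd r; pose f s := (x * s)%g.
have f_inj n : injective (iter n f).
  by elim: n => // n IHn s t /(mul_injective nzd)/IHn.
have [|N stable] := art _ (right_ideal_iter_mul x).
  by move=> n _ [s _ <-]; exists (f s) => //; rewrite iterSr.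
have : range (iter N f) (iter N f r) by exists r.
rewrite -(stable N.+1) // => -[s _ xNr]; exists s.
by apply: (f_inj N); rewrite -iterSr.
Qed.

(** If x were not a left zero divisor, it would be right invertible with
    respect to a two-sided identity. *)
Lemma right_zero_divisor_is_left x :
    right_artinian R ->
    (forall e, is_left_identity e -> is_right_identity e) ->
  is_right_zero_divisor x -> is_left_zero_divisor x.
Proof.
move=> art left_right [y [y0 yx]]; apply: contrapT => nzd.
have surj := mul_surjective art nzd.
have [e xe] := surj x.
have e_left : is_left_identity e.
  by move=> r; apply: (mul_injective nzd); rewrite mulgA xe.
have [s xs] := surj e.
by apply: y0; rewrite -(left_right e e_left y) -xs mulgA yx rng_mul0r.
Qed.

End ZeroDivisors.

Lemma left_zero_divisor_is_right (R : rngType) (x : R) :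
    left_artinian R ->
    (forall e : R, is_right_identity e -> is_left_identity e) ->
  is_left_zero_divisor x -> is_right_zero_divisor x.
Proof.
move=> /right_artinian_opposite.
exact: (@right_zero_divisor_is_left (opposite_rng R)).
Qed.

(** * Walks in digraphs *)

Section Walks.
Variables (T : eqType) (G : digraph T).
Implicit Types x y z : T.

(** Repeated vertices are allowed, which makes the relation transitive;
    [digraph_connected_walk] cuts the loops afterwards. *)
Definition joined_by_walk x y :=
  exists2 p, path (fun u v => `[< is_arc G u v >]) x p & last x p = y.

Lemma walk_refl x : joined_by_walk x x.
Proof. by exists [::]. Qed.

Lemma walk_arc x y : is_arc G x y -> joined_by_walk x y.
Proof. by move=> /asboolP xy; exists [:: y] => //=; rewrite xy. Qed.

Lemma walk_trans y x z :
  joined_by_walk x y -> joined_by_walk y z -> joined_by_walk x z.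
Proof.
by move=> [p xp py] [q yq qz]; exists (p ++ q);
  rewrite ?cat_path ?last_cat py ?xp.
Qed.

Lemma digraph_connected_walk :
  (forall x y, is_vertex G x -> is_vertex G y -> joined_by_walk x y) ->
  digraph_connected G.
Proof.
move=> walks x y Gx Gy _; have [p xp <-] := walks x y Gx Gy.
by case/shortenP: xp => q xq uq _; exists q.
Qed.

Lemma connected_out_arc x y : digraph_connected G ->
  is_vertex G x -> is_vertex G y -> x <> y -> exists z, is_arc G x z.
Proof.
move=> conn Gx Gy xy; have [[|z p] [/= xp last_p _]] := conn x y Gx Gy xy.
  by case: xy.
by exists z; case/andP: xp => /asboolP.
Qed.

Lemma connected_in_arc x y : digraph_connected G ->
  is_vertex G x -> is_vertex G y -> x <> y -> exists z, is_arc G z y.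
Proof.
move=> conn Gx Gy xy; have [p] := conn x y Gx Gy xy.
case/lastP: p => [|p z] [xp last_p _]; first by case: xy.
move: xp last_p; rewrite rcons_path last_rcons => /andP[_ /asboolP arc] <-.
by exists (last x p).
Qed.

End Walks.

Lemma sub_digraph_connected (T : eqType) (G H : digraph T) :
  (forall x, is_vertex H x -> is_vertex G x) ->
  (forall x y, is_arc G x y -> is_arc H x y) ->
  digraph_connected G -> digraph_connected H.
Proof.
move=> HG GH conn x y /HG Gx /HG Gy /(conn x y Gx Gy)[p [xp py up]].
exists p; split=> //; apply: sub_path xp => u v /asboolP uv.
exact/asboolP/GH.
Qed.

(** * Connectedness of the two digraphs *)

Section Connectedness.
Variable R : rngType.
Implicit Types x y e : R.

Lemma connected_extended : digraph_connected (zero_divisor_digraph R) ->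
  digraph_connected (extended_zero_divisor_digraph R).
Proof.
apply: sub_digraph_connected => // x y [Vx Vy xy xy0].
by split=> //; exists 1%N, 1%N; split=> //; [case: Vx | case: Vy].
Qed.

Lemma connected_of_same_zero_divisors :
  (forall x, is_left_zero_divisor x <-> is_right_zero_divisor x) ->
  digraph_connected (zero_divisor_digraph R).
Proof.
move=> lr; apply: digraph_connected_walk.
(* Two equal consecutive vertices are no arc, but the walk may stay put. *)
have step u v : u <> 0 -> v <> 0 -> (u * v)%g = 0 ->
    joined_by_walk (zero_divisor_digraph R) u v.
  move=> u0 v0 uv; have [->|/eqP uDv] := eqVneq u v; first exact: walk_refl.
  apply: walk_arc; split=> //; split=> //; first by left; exists v.
  by right; exists u.
move=> x y [Zx x0] [Zy y0].
have [a [a0 xa]] : is_left_zero_divisor x by case: Zx => // /lr.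
have [b [b0 yb]] : is_right_zero_divisor y by case: Zy => // /lr.
have [ab|ab] := pselect ((a * b)%g = 0).
  exact: walk_trans (step x a x0 a0 xa)
    (walk_trans (step a b a0 b0 ab) (step b y b0 y0 yb)).
apply: (@walk_trans _ _ (a * b)%g); apply: step => //.
  by rewrite mulgA xa rng_mul0r.
by rewrite -mulgA yb rng_mulr0.
Qed.

(** Otherwise e and some y <> 0 with y e = 0 are distinct vertices, but no arc
    leaves e, because e^n z^m = z^m. *)
Lemma left_identity_is_right e :
    digraph_connected (extended_zero_divisor_digraph R) ->
  is_left_identity e -> is_right_identity e.
Proof.
move=> conn el r; apply: subr0_eq; apply: contrapT; set y := _ - _ => y0.
have ye : (y * e)%g = 0 by rewrite rng_mulrBl -mulgA el subrr.
have e0 : e <> 0 by move=> e0; apply: y0; rewrite -(el y) e0 rng_mul0r.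
have eDy : e <> y by move=> ey; apply: e0; rewrite -(el e) {1}ey.
have Ve : (zero_divisors R `\ 0) e by split=> //; right; exists y.
have Vy : (zero_divisors R `\ 0) y by split=> //; left; exists e.
have [z [_ _ _ [n [m [n0 _]]]]] := connected_out_arc conn Ve Vy eDy.
by rewrite rng_exp_idem ?el // => -> _ /(_ erefl).
Qed.

Lemma right_identity_is_left e :
    digraph_connected (extended_zero_divisor_digraph R) ->
  is_right_identity e -> is_left_identity e.
Proof.
move=> conn er r; apply: subr0_eq; apply: contrapT; set y := _ - _ => y0.
have ey : (e * y)%g = 0 by rewrite rng_mulrBr mulgA er subrr.
have e0 : e <> 0 by move=> e0; apply: y0; rewrite -(er y) e0 rng_mulr0.
have yDe : y <> e by move=> ye; apply: e0; rewrite -(er e) -{2}ye.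
have Ve : (zero_divisors R `\ 0) e by split=> //; left; exists y.
have Vy : (zero_divisors R `\ 0) y by split=> //; right; exists e.
have [z [_ _ _ [n [m [_ m0]]]]] := connected_in_arc conn Vy Ve yDe.
by rewrite (rng_exp_idem (er e)) // er => ->.
Qed.

End Connectedness.

Theorem theorem6p10 (R : rngType) (hart : artinian R)
    (hnc : noncommutative_rng R) :
  [<-> digraph_connected (extended_zero_divisor_digraph R);
       digraph_connected (zero_divisor_digraph R);
       forall e : R, is_one_sided_identity e -> is_two_sided_identity e].
Proof.
have [lart rart] := hart.
have identities : digraph_connected (extended_zero_divisor_digraph R) ->
    forall e : R, is_one_sided_identity e -> is_two_sided_identity e.
  move=> conn e [el|er]; split=> //.
    exact: left_identity_is_right.
  exact: right_identity_is_left.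
have connected :
    (forall e : R, is_one_sided_identity e -> is_two_sided_identity e) ->
    digraph_connected (zero_divisor_digraph R).
  move=> two_sided; apply: connected_of_same_zero_divisors => x; split.
    by apply: left_zero_divisor_is_right => // e er;
      case: (two_sided e (or_intror er)).
  by apply: right_zero_divisor_is_left => // e el;
    case: (two_sided e (or_introl el)).
tfae.
- by move=> /identities/connected.
- by move=> /connected_extended/identities.
- by move=> /connected/connected_extended.
Qed.
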